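(* For each integer $n\ge 1$, let $B_{2n+1}$ be the bouquet with edge set $\{1,2,\dots,2n+1\}$ and signed rotation $$(1,\,2,\,3,\,4,\,5,\,\dots,\,2n,\,2n+1,\,-1,\,2n,\,2n+1,\,\dots,\,4,\,5,\,2,\,3).$$ Then the partial-dual Euler genus polynomial of $B_{2n+1}$ is $${}^{\partial}\varepsilon_{B_{2n+1}}(z)=2^{n+1}z^{2n+1}+\sum_{s=1}^{n}2^{n+1}\binom{n}{s}z^{2n-2s+2}.$$
   Context: A ribbon graph $G$ is a (possibly non-orientable) surface with boundary given as the union of vertex-discs $V(G)$ and edge-ribbons (discs) $E(G)$, where vertex-discs are pairwise disjoint, ribbons are pairwise disjoint, and each ribbon meets the vertex-discs in exactly two disjoint arcs (its ends, or half-edges), each lying on the boundary of exactly one vertex-disc. For a connected ribbon graph $G$ with $v$ vertices, $e$ edges and $f$ boundary components, the Euler genus $\varepsilon(G)$ is defined by $v-e+f=2-\varepsilon(G)$. For $A\subseteq E(G)$, the partial dual $G^A$ is the ribbon graph obtained by gluing a disc along each boundary component of the spanning ribbon subgraph $(V(G),A)$ (these discs are the vertices of $G^A$) and then removing the interiors of all original vertex-discs; its edges are the ribbons of $G$. The partial-dual Euler genus polynomial is ${}^{\partial}\varepsilon_G(z)=\sum_{A\subseteq E(G)}z^{\varepsilon(G^A)}$. A bouquet is a ribbon graph with exactly one vertex. A signed rotation of a bouquet is the cyclic ordering of the half-edges around the vertex, each half-edge being written as the label of its edge together with a sign: the two half-edges of an edge get the same sign $+$ if the edge is an untwisted loop,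 and different signs (one $+$, one $-$) if it is a twisted loop. The sign $+$ is omitted. The signed rotation determines the bouquet. In the signed rotation of $B_{2n+1}$, after the entry $-1$ the pairs $2i,2i+1$ occur in decreasing order of $i$, from $i=n$ to $i=1$, with $2i$ immediately followed by $2i+1$ in each pair. Thus edge $1$ is twisted and all other edges are untwisted. *)

(* Defs.v *)
From mathcomp Require Import all_boot all_order all_algebra.

Set Implicit Arguments.
Unset Strict Implicit.
Unset Printing Implicit Defensive.

Import GRing.Theory Num.Theory.

Local Open Scope ring_scope.

(* A ribbon graph, up to homeomorphism, is recorded by the corners of its
   ribbons.  A ribbon is a rectangle attached to the vertex-discs along two
   opposite sides, its ends; the other two sides are free.  For a corner x,
     [side x] is the other endpoint of the free side of the ribbon at x,
     [across x] is the other endpoint of the end of the ribbon at x,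
     [vertex_arc x] is the other endpoint of the arc that starts at x on the
       boundary of a vertex-disc and meets no ribbon in its interior.
   Vertex-discs that meet no ribbon have no corner, so they are counted
   separately, by [isolated]. *)
Record ribbon_graph := RibbonGraph {
  edge : finType;
  corner : finType;
  ribbon : corner -> edge;
  side : corner -> corner;
  across : corner -> corner;
  vertex_arc : corner -> corner;
  isolated : nat;
  sideK : involutive side;
  acrossK : involutive across;
  vertex_arcK : involutive vertex_arc;
  vertex_arc_neq : forall x, vertex_arc x != x;
  side_across : forall x, side (across x) = across (side x);
  corners_uniq : forall x, uniq [:: x; side x; across x; side (across x)];
  ribbonE : forall x y,
    (ribbon x == ribbon y) = (y \in [:: x; side x; across x; side (across x)]);
  ribbon_onto : forall e, exists x, ribbon x = e
}.

(* The orbits of the group generated by fs, when fs consists of involutions. *)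
Definition orbit_count (T : finType) (fs : seq (T -> T)) : nat :=
  n_comp [rel x y | has (fun f => y == f x) fs] T.

Definition nb_vertices (G : ribbon_graph) : nat :=
  (isolated G + orbit_count [:: @across G; @vertex_arc G])%N.

Definition nb_edges (G : ribbon_graph) : nat := #|edge G|.

Definition nb_boundaries (G : ribbon_graph) : nat :=
  (isolated G + orbit_count [:: @side G; @vertex_arc G])%N.

Definition nb_components (G : ribbon_graph) : nat :=
  (isolated G + orbit_count [:: @side G; @across G; @vertex_arc G])%N.

(* v - e + f = 2 c - eps, with c = 1 when G is connected.  The subtraction
   in nat is not truncated, since v - e + f <= 2 c for every surface. *)
Definition euler_genus (G : ribbon_graph) : nat :=
  (2 * nb_components G + nb_edges G - (nb_vertices G + nb_boundaries G))%N.

Section PartialDual.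

Variables (G : ribbon_graph) (A : {set edge G}).

(* The boundary of the spanning ribbon subgraph (V(G), A) follows the arcs,
   the free sides of the ribbons in A, and the ends of the ribbons that are
   not in A.  The vertex-discs of the partial dual are glued along these
   curves, so a ribbon in A becomes attached along its former free sides, and
   its former ends become free. *)
Definition dual_across (x : corner G) : corner G :=
  if ribbon x \in A then side x else across x.

Definition dual_side (x : corner G) : corner G :=
  if ribbon x \in A then across x else side x.

Lemma ribbon_side (x : corner G) : ribbon (side x) = ribbon x.
Proof. by apply/esym/eqP; rewrite ribbonE !inE eqxx orbT. Qed.

Lemma ribbon_across (x : corner G) : ribbon (across x) = ribbon x.
Proof. by apply/esym/eqP; rewrite ribbonE !inE eqxx !orbT. Qed.

Lemma dual_sideK : involutive dual_side.
Proof.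
move=> x; rewrite /dual_side; case xA: (ribbon x \in A);
  by rewrite ?(ribbon_side, ribbon_across) xA ?sideK ?acrossK.
Qed.

Lemma dual_acrossK : involutive dual_across.
Proof.
move=> x; rewrite /dual_across; case xA: (ribbon x \in A);
  by rewrite ?(ribbon_side, ribbon_across) xA ?sideK ?acrossK.
Qed.

Lemma dual_side_across x :
  dual_side (dual_across x) = dual_across (dual_side x).
Proof.
rewrite /dual_side /dual_across; case xA: (ribbon x \in A);
  by rewrite !(ribbon_side, ribbon_across, xA) side_across.
Qed.

Lemma dual_corners x :
  perm_eq [:: x; dual_side x; dual_across x; dual_side (dual_across x)]
          [:: x; side x; across x; side (across x)].
Proof.
rewrite /dual_side /dual_across; case xA: (ribbon x \in A).
  rewrite ribbon_side xA side_across perm_cons.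
  by rewrite -[_ :: _ :: _]/([:: _] ++ [:: _] ++ _) perm_catCA.
by rewrite ribbon_across xA.
Qed.

Lemma dual_corners_uniq x :
  uniq [:: x; dual_side x; dual_across x; dual_side (dual_across x)].
Proof. by rewrite (perm_uniq (dual_corners x)) corners_uniq. Qed.

Lemma dual_ribbonE x y :
  (ribbon x == ribbon y) =
  (y \in [:: x; dual_side x; dual_across x; dual_side (dual_across x)]).
Proof. by rewrite ribbonE (perm_mem (dual_corners x)). Qed.

Definition partial_dual : ribbon_graph :=
  RibbonGraph (isolated G) dual_sideK dual_acrossK (@vertex_arcK G)
    (@vertex_arc_neq G) dual_side_across dual_corners_uniq dual_ribbonE
    (@ribbon_onto G).

End PartialDual.

Definition partial_dual_genus_poly (G : ribbon_graph) : {poly int} :=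
  \sum_(A : {set edge G}) 'X^(euler_genus (partial_dual A)).

(* A half-edge of the edge labelled k > 0 is written k or -k, according to
   its sign. *)
Definition is_signed_rotation (w : seq int) : bool :=
  (0 \notin w) && all (fun h => count (fun k => `|k| == `|h|) w == 2%N) w.

Definition signed_rotation := {w : seq int | is_signed_rotation w}.

Section Bouquet.

Variable r : signed_rotation.

Let w : seq int := val r.

Definition half_edge : finType := 'I_(size w).

Definition entry (p : half_edge) : int := tnth (in_tuple w) p.

Definition labels : seq nat := [seq `|h|%N | h : int <- w].

Lemma label_subproof (p : half_edge) : `|entry p|%N \in labels.
Proof. exact/map_f/mem_tnth. Qed.

Definition label (p : half_edge) : seq_sub labels := SeqSub (label_subproof p).

Definition partner (p : half_edge) : half_edge :=
  odflt p [pick q | (q != p) && (label q == label p)].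

Lemma card_label (p : half_edge) : #|[pred q | label q == label p]| = 2%N.
Proof.
have /andP[_ /allP/(_ _ (mem_tnth p (in_tuple w)))/eqP <-] := valP r.
rewrite -sum1_count -sum1_card (big_tnth _ _ w) /=; apply: eq_bigl => q.
by rewrite !inE -val_eqE /= -eqz_nat !abszE.
Qed.

Lemma partnerE (p q : half_edge) :
  ((q != p) && (label q == label p)) = (q == partner p).
Proof.
have := card_label p; rewrite (cardD1 p) inE eqxx => -[] /mem_card1 [s sP].
have {}sP u : ((u != p) && (label u == label p)) = (u == s).
  by have := sP u; rewrite !inE.
rewrite sP /partner; case: pickP => [u | none] /=; first by rewrite sP => /eqP->.
by have := none s; rewrite sP eqxx.
Qed.

Lemma partner_neq p : partner p != p.
Proof. by have := partnerE p (partner p); rewrite eqxx => /andP[]. Qed.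

Lemma label_partner p : label (partner p) = label p.
Proof. by have := partnerE p (partner p); rewrite eqxx => /andP[_ /eqP]. Qed.

Lemma partnerK : involutive partner.
Proof.
move=> p; apply/esym/eqP.
by rewrite -partnerE label_partner eqxx eq_sym partner_neq.
Qed.

(* The boundary of the vertex-disc is traversed in the order of the signed
   rotation: (p, false) is the corner at which the half-edge in position p is
   entered, and (p, true) the one at which it is left. *)
Definition half_edge_corner : finType := (half_edge * bool)%type.

Definition untwisted (p : half_edge) : bool :=
  (entry p < 0) == (entry (partner p) < 0).

Definition rotation_across (x : half_edge_corner) : half_edge_corner :=
  (x.1, ~~ x.2).

Definition rotation_arc (x : half_edge_corner) : half_edge_corner :=
  if x.2 then (ordS x.1, false) else (ord_pred x.1, true).

(* A free side of an untwisted loop joins the corner at which one end is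
   entered to the corner at which the other end is left. *)
Definition rotation_side (x : half_edge_corner) : half_edge_corner :=
  (partner x.1, x.2 (+) untwisted x.1).

Lemma untwisted_partner p : untwisted (partner p) = untwisted p.
Proof. by rewrite /untwisted partnerK eq_sym. Qed.

Lemma rotation_sideK : involutive rotation_side.
Proof.
case=> p b; rewrite /rotation_side /= partnerK untwisted_partner.
by rewrite -addbA addbb addbF.
Qed.

Lemma rotation_acrossK : involutive rotation_across.
Proof. by case=> p b; rewrite /rotation_across /= negbK. Qed.

Lemma rotation_arcK : involutive rotation_arc.
Proof.
by case=> p [] /=; rewrite /rotation_arc /= ?ordSK ?ord_predK.
Qed.

Lemma rotation_arc_neq x : rotation_arc x != x.
Proof. by case: x => p []; rewrite /rotation_arc xpair_eqE /= andbF. Qed.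

Lemma rotation_side_across x :
  rotation_side (rotation_across x) = rotation_across (rotation_side x).
Proof. by case: x => p b; rewrite /rotation_side /rotation_across /= addNb. Qed.

Lemma rotation_corners_uniq x :
  uniq [:: x; rotation_side x; rotation_across x;
           rotation_side (rotation_across x)].
Proof.
case: x => p b; rewrite /rotation_side /rotation_across /= !inE !xpair_eqE /=.
rewrite (eq_sym p) (negPf (partner_neq p)) eqxx.
by case: b; case: untwisted; rewrite /= eqxx.
Qed.

Lemma rotation_ribbonE (x y : half_edge_corner) :
  (label x.1 == label y.1) =
  (y \in [:: x; rotation_side x; rotation_across x;
             rotation_side (rotation_across x)]).
Proof.
case: x y => p b [q c]; rewrite /rotation_side /rotation_across /=.
have -> : (label p == label q) = (q == p) || (q == partner p).
  by rewrite -partnerE (eq_sym (label p)); case: (eqVneq q p) => [->|_]; rewrite ?eqxx.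
rewrite !inE !xpair_eqE /=.
by case: (q == p); case: (q == partner p); case: b; case: c; case: untwisted.
Qed.

Lemma rotation_ribbon_onto (e : seq_sub labels) :
  exists x : half_edge_corner, label x.1 = e.
Proof.
case: e => k k_in; have [h /(tnthP (in_tuple w))[p ->] k_p] := mapP k_in.
by exists (p, false); apply: val_inj.
Qed.

(* The empty rotation is that of a single isolated vertex-disc. *)
Definition bouquet_of_rotation : ribbon_graph :=
  RibbonGraph (size w == 0%N) rotation_sideK rotation_acrossK rotation_arcK
    rotation_arc_neq rotation_side_across rotation_corners_uniq
    rotation_ribbonE rotation_ribbon_onto.

Lemma bouquet_one_vertex : nb_vertices bouquet_of_rotation = 1%N.
Proof.
rewrite /nb_vertices /orbit_count /= -/half_edge_corner.
set e := (X in n_comp X _).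
have [w0 | w_gt0] := posnP (size w).
  rewrite /n_comp_mem eq_card0 // => -[[i i_lt] b].
  by exfalso; move: i_lt; rewrite w0.
have e_sym : symmetric e.
  have swap f : involutive f -> forall x y, (y == f x) = (x == f y).
    by move=> fK x y; apply/eqP/eqP => ->; rewrite fK.
  by move=> x y; rewrite /e /= (swap _ _ rotation_acrossK) (swap _ _ rotation_arcK).
have c_sym := sym_connect_sym e_sym.
pose x0 : half_edge_corner := (Ordinal w_gt0, false).
rewrite add0n -(n_comp_connect c_sym x0).
have x0P i (i_lt : (i < size w)%N) b : connect e x0 (Ordinal i_lt, b).
  have e_b (p : half_edge) : connect e (p, false) (p, b).
    by case: b => //; apply: connect1; rewrite /e /= eqxx.
  elim: i i_lt => [|i IHi] i_lt.
    have -> : Ordinal i_lt = Ordinal w_gt0 by apply: val_inj.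
    exact: e_b.
  have i_lt' := ltnW i_lt.
  apply: connect_trans (e_b _); apply: connect_trans (IHi i_lt') _.
  apply: (@connect_trans _ _ (Ordinal i_lt', true)).
    case: b {IHi e_b} => //.
    by apply: connect1; rewrite /e /= eqxx.
  apply: connect1; rewrite /e /= /rotation_arc /= orbF; apply/orP; right.
  by apply/eqP; congr (_, _); apply: val_inj; rewrite /= modn_small.
by apply: eq_n_comp_r => -[[i i_lt] b]; rewrite !inE; apply/esym/x0P.
Qed.

End Bouquet.

(* 1, 2, ..., 2n+1, -1, 2n, 2n+1, ..., 4, 5, 2, 3 *)
Definition rotation_B (n : nat) : seq int :=
  [seq k%:Z | k <- iota 1 (2 * n + 1)] ++
  (-1) :: flatten [seq [:: (2 * i)%N%:Z; (2 * i + 1)%N%:Z] | i <- rev (iota 1 n)].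

Lemma rotation_B_labels n :
  perm_eq [seq `|h|%N | h : int <- rotation_B n]
          (iota 1 (2 * n + 1) ++ iota 1 (2 * n + 1)).
Proof.
rewrite map_cat -map_comp map_id_in // perm_cat2l /=.
rewrite addn1 /= perm_cons map_flatten -map_comp.
elim: n => [|n IHn] //.
rewrite (_ : iota 1 n.+1 = rcons (iota 1 n) n.+1); last first.
  by rewrite -[in LHS](addn1 n) iotaD cats1.
rewrite rev_rcons (_ : 2 * n.+1 = 2 * n + 2)%N; last by rewrite mulnS addnC.
rewrite -(perm_cat2l [:: 2 * n.+1; 2 * n.+1 + 1]%N) in IHn.
apply: perm_trans IHn _; rewrite perm_catC iotaD perm_cat2l mulnS.
by rewrite (addnC _ 1%N).
Qed.

Lemma rotation_B_signed n : is_signed_rotation (rotation_B n).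
Proof.
have lab := rotation_B_labels n; apply/andP; split.
  apply/negP => /(map_f absz); rewrite (perm_mem lab) mem_cat orbb mem_iota.
  by [].
apply/allP => h /(map_f absz); rewrite (perm_mem lab) mem_cat orbb => h_in.
rewrite (@eq_count _ _ (preim absz (pred1 `|h|%N))); last first.
  by move=> k; rewrite /= -eqz_nat !abszE.
rewrite -count_map (permP lab) count_cat.
by rewrite count_uniq_mem ?iota_uniq // h_in.
Qed.

Definition bouquet_B (n : nat) : ribbon_graph :=
  bouquet_of_rotation (exist _ (rotation_B n) (rotation_B_signed n)).

(* Main.v *)
Require Import Defs.
From mathcomp Require Import all_boot all_order all_algebra.
From mathcomp Require Import zify.

(** For a bouquet B and a set A of loops, let f(A) be the number of boundary
    components of the spanning ribbon subgraph with ribbon set A.  These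
    components bound the vertex-discs of the partial dual B^A, and the boundary
    components of B^A are those of the subgraph on the complement of A.  As B
    is connected, the Euler genus of B^A is therefore
    2 + #|E(B)| - f(A) - f(~: A), and everything reduces to computing f.

    The number f(A) is computed by counting, in two ways, the black and white
    colourings of the boundary components of (V, A): there are 2 ^ f(A) of
    them.  Walk once around the vertex-disc: the colour can change only when an
    end of a ribbon of A is passed, and it changes at both ends of a ribbon or
    at neither.  So a colouring is given by the colour at the starting point
    and the set X of the ribbons of A whose two sides have different colours.
    Such an X comes from a colouring exactly when, for each loop in A, the
    colours at both ends of a free side agree, which is a parity condition on
    the loops of X met between the two ends of the loop.  These conditions say
    that X lies in the kernel of the intersection matrix of A over the field
    with two elements; see [card_bicoloured_edges] and [side_consistent_loop].

    In B_{2n+1} the twisted loop 1 interlaces every other loop, and 2i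
    interlaces otherwise only its mate 2i+1.  If the twisted loop were in X,
    then X would be all of A, with an odd number of elements, against the
    condition at the twisted loop.  Hence X consists of loops of A whose mate is
    not in A, and, when 1 is in A, it has an even number of elements
    ([bicoloured_B]).  Let d be the number of pairs {2i, 2i+1} with exactly one
    member in A, a number shared by A and its complement.  It follows that
    f(A) = d + 1 when 1 is not in A, and f(A) = max(d, 1) when 1 is in A.
    Exactly one of A and ~: A contains 1, so the genus of B^A is 2n + 1 if
    d = 0 and 2n - 2d + 2 otherwise.  Finally 2 ^ (n + 1) * 'C(n, d) sets A
    have d split pairs: choose these pairs, then the presence in A of each
    2i and of 1. *)

Set Implicit Arguments.
Unset Strict Implicit.
Unset Printing Implicit Defensive.

Import GRing.Theory Num.Theory.

(** * Counting orbits by counting invariant colourings *)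

Section Colourings.

Variable T : finType.
Implicit Types (f : T -> T) (fs : seq (T -> T)) (C : {set T}).

(** This is the relation whose connected components [orbit_count] counts. *)
Definition step fs : rel T := [rel x y | has (fun f => y == f x) fs].

(** A colouring in two colours is encoded as its set of black points. *)
Definition colourings fs : {set {set T}} :=
  [set C : {set T} | all (fun f => f @^-1: C == C) fs].

Lemma colouringP fs C :
  reflect (forall x y, step fs x y -> (x \in C) = (y \in C))
          (C \in colourings fs).
Proof.
rewrite inE; elim: fs => [|f fs IHfs] /=; first by apply: ReflectT.
apply: (iffP andP) => [[/eqP fC /IHfs fsC] x y|sC].
  by case/orP=> [/eqP-> | /fsC//]; rewrite -{1}fC inE.
split; last by apply/IHfs => x y xy; apply: sC; apply/orP; right.
by apply/eqP/setP => x; rewrite inE; apply/esym/sC; rewrite /step /= eqxx.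
Qed.

Definition involutions fs : Prop :=
  foldr (fun f P => involutive f /\ P) True fs.

Lemma involutions_sym fs : involutions fs -> symmetric (step fs).
Proof.
elim: fs => [|f fs IHfs] //= [fK /IHfs fsS] x y.
rewrite /step /=; congr (_ || _); last exact: fsS.
by apply/eqP/eqP => ->; rewrite fK.
Qed.

(** An invariant colouring is a free choice of a colour for each orbit.  Through
    this lemma orbits are counted without any orbit being described. *)
Lemma card_colourings fs :
  involutions fs -> #|colourings fs| = 2 ^ orbit_count fs.
Proof.
move=> /involutions_sym s_sym; have c_sym := sym_connect_sym s_sym.
pose R := [set x | roots (step fs) x].
have -> : orbit_count fs = #|R|.
  by apply: eq_card => x; rewrite !inE andbT.
rewrite -card_powerset.
pose spread (S : {set T}) := [set x | fingraph.root (step fs) x \in S].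
rewrite -(@card_in_imset _ _ spread (powerset R)) => [|S1 S2]; last first.
  rewrite !powersetE => /subsetP S1R /subsetP S2R eqS; apply/setP => x.
  case xR: (x \in R); last first.
    by rewrite (contraFF (S1R x)) ?(contraFF (S2R x)).
  have := congr1 (fun S : {set T} => x \in S) eqS.
  by rewrite !inE; move: xR; rewrite inE => /eqP->.
apply: eq_card => C; apply/idP/imsetP => [/colouringP cC|[S _ ->]].
  exists (C :&: R); first by rewrite powersetE subsetIr.
  apply/setP => x; rewrite !inE roots_root // andbT.
  exact: (closed_connect cC (connect_root _ x)).
apply/colouringP => x y xy; rewrite !inE.
by rewrite (fingraph.rootP c_sym (connect1 xy)).
Qed.

End Colourings.

(** * Boundary colourings of a spanning ribbon subgraph of a bouquet *)

Section Tour.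

Variable r : signed_rotation.

Local Notation B := (bouquet_of_rotation r).
Local Notation perimeter := (size (val r)).

(** The loops in the order in which their ends are met around the vertex-disc,
    so that every loop occurs twice. *)
Definition tour : seq (edge B) := codom (@label r).

(** Whether the colour at the gap after [m] half-edges differs from the colour
    at the origin of the tour, when the colour changes at the ends of the loops
    of [X] and nowhere else. *)
Definition crossings (X : {set edge B}) (m : nat) : bool :=
  odd (count (mem X) (take m tour)).

Lemma size_tour : size tour = perimeter.
Proof. by rewrite size_codom card_ord. Qed.

Lemma take_tour (p : half_edge r) :
  take p.+1 tour = rcons (take p tour) (label p).
Proof.
have p_lt : p < size tour by rewrite size_tour.
rewrite (take_nth (label p)) //; congr rcons.
by rewrite /tour codomE (nth_map p) ?size_enum_ord // nth_ord_enum.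
Qed.

Lemma crossingsS X (p : half_edge r) :
  crossings X p.+1 = crossings X p (+) (label p \in X).
Proof. by rewrite /crossings take_tour -cats1 count_cat oddD /= addn0 oddb. Qed.

(** Every loop has two ends, so the colour is the initial one again after a full
    turn. *)
Lemma crossings_perimeter X : crossings X perimeter = false.
Proof.
rewrite /crossings -size_tour take_size /tour codomE count_map.
rewrite -sum1_count big_enum_cond /=.
rewrite (partition_big (@label r) (mem X)) //=.
rewrite (eq_bigr (fun=> 2)) => [|e eX].
  by rewrite sum_nat_const oddM andbF.
have [[p b] /= eq_p] := rotation_ribbon_onto e; rewrite -{e}eq_p in eX *.
rewrite -(card_label p) -sum1_card; apply: eq_bigl => q.
by rewrite !inE; case: eqP => [-> | _]; rewrite ?andbF ?andbT ?eX.
Qed.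

(** The corner [(p, b)] lies on the gap number [p + b], so these are the two
    gaps that a free side of the ribbon at [p] joins: the corner [(p, false)]
    goes to [(partner p, untwisted p)].  The other free side gives the same
    condition, as the colour changes by the same amount at both ends. *)
Definition side_consistent (X : {set edge B}) (p : half_edge r) : bool :=
  crossings X p == crossings X (partner p + untwisted p).

(** The sets of ribbons that arise, for some boundary colouring of the subgraph
    with ribbon set [A], as the ribbons whose sides have different colours. *)
Definition bicoloured_edges (A : {set edge B}) : {set {set edge B}} :=
  [set X : {set edge B} |
     (X \subset A) && [forall p, (label p \in A) ==> side_consistent X p]].

(** The colouring with a given colour at the origin of the tour and a given set
    of ribbons at whose ends the colour changes. *)
Definition paint (cX : bool * {set edge B}) : {set corner B} :=
  [set x : corner B | cX.1 (+) crossings cX.2 (x.1 + x.2)].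

Definition dual_steps (A : {set edge B}) : seq (corner B -> corner B) :=
  [:: @dual_across B A; @vertex_arc B].

Lemma paint_colouring A cX :
  cX.2 \in bicoloured_edges A -> paint cX \in colourings (dual_steps A).
Proof.
case: cX => c X /=; rewrite inE => /andP[/subsetP XA /forallP ret].
rewrite inE /= andbT; apply/andP.
split; apply/eqP/setP => -[p b]; rewrite !inE /=.
  congr (c (+) _); rewrite /dual_across /=; case: ifP => pA /=.
    have /implyP/(_ pA)/eqP ret_p := ret p.
    case: b => /=; last by rewrite addn0 ret_p.
    rewrite addn1 crossingsS ret_p; case: untwisted => /=.
      by rewrite addn0 addn1 crossingsS label_partner -addbA addbb addbF.
    by rewrite addn0 addn1 crossingsS label_partner.
  have pX : label p \in X = false by apply: contraFF pA => /XA.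
  by case: b; rewrite /= addn0 addn1 crossingsS pX addbF.
congr (c (+) _); rewrite /rotation_arc; case: b => /=.
  have [lt | le] := ltnP p.+1 perimeter.
    by rewrite modn_small // addn0 addn1.
  (* the arc from the last half-edge back to the first one *)
  have eqm : p.+1 = perimeter by apply/eqP; rewrite eqn_leq le ltn_ord.
  by rewrite {1}eqm modnn addn1 eqm crossings_perimeter /crossings take0.
have N_gt0 : 0 < perimeter by apply: leq_ltn_trans (ltn_ord p).
case: (posnP p) => [p0 | p_gt0].
  rewrite p0 /= add0n modn_small ?prednK // addn0 addn1 prednK //.
  by rewrite crossings_perimeter /crossings take0.
rewrite addn0 addn1; congr crossings.
rewrite -(prednK p_gt0) addSn /= modnDr modn_small //.
by rewrite (leq_ltn_trans _ (ltn_ord p)) // leq_pred.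
Qed.

Section NonEmpty.

Hypothesis perimeter_gt0 : 0 < perimeter.

Let start : corner B := (Ordinal perimeter_gt0, false).

Lemma paint_inj : injective paint.
Proof.
move=> [c X] [d Y] eq_paint.
have E x : (x \in paint (c, X)) = (x \in paint (d, Y)) by rewrite eq_paint.
have cd : c = d by have := E start; rewrite !inE /= /crossings !take0 /= !addbF.
congr (_, _) => //; apply/setP => e.
have [[p b] /= <-] := rotation_ribbon_onto e.
have := E (p, true); have := E (p, false); rewrite !inE /= addn0 addn1 cd.
by move=> /addbI E0 /addbI; rewrite !crossingsS E0 => /addbI.
Qed.

(** The colour changes by the same amount at both ends of a loop: the two sides
    of a ribbon of [A] carry the colours from one end to the other, and nothing
    changes across an end of a ribbon outside [A].  So the set [X] of the loops
    at which it changes is well defined, and the colouring is recovered from it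
    by following the tour. *)
Lemma paint_surj A C : C \in colourings (dual_steps A) ->
  exists2 cX, cX.2 \in bicoloured_edges A & C = paint cX.
Proof.
rewrite inE /= andbT => /andP[/eqP acrossC /eqP arcC].
pose jump (p : half_edge r) := ((p, false) \in C) (+) ((p, true) \in C).
have acrossE x : (@dual_across B A x \in C) = (x \in C).
  by rewrite -[in RHS]acrossC inE.
have arcE (x : corner B) : (vertex_arc x \in C) = (x \in C).
  by rewrite -[in RHS]arcC inE.
have jumpA p : label p \notin A -> jump p = false.
  move=> pA; have := acrossE (p, false); rewrite /dual_across /= (negPf pA).
  by rewrite /jump => ->; rewrite addbb.
have jump_partner p : jump (partner p) = jump p.
  have [pA | pA] := boolP (label p \in A); last first.
    by rewrite !jumpA // label_partner.
  have := acrossE (p, false); have := acrossE (p, true).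
  rewrite /dual_across /= pA /rotation_side /jump /=.
  by case: untwisted => /= -> ->; rewrite // addbC.
pose X : {set edge B} := [set label p | p : half_edge r & jump p].
have jumpX p : (label p \in X) = jump p.
  apply/imsetP/idP => [[q] | jp]; last by exists p; rewrite ?inE.
  rewrite inE => jq eq_pq; have [<- // | qp] := eqVneq q p.
  have := partnerE p q; rewrite qp eq_pq eqxx => /esym/eqP q_p.
  by rewrite -(partnerK p) -q_p jump_partner.
have after (p : half_edge r) :
    ((p, false) \in C) = (start \in C) (+) crossings X p ->
    ((p, true) \in C) = (start \in C) (+) crossings X p.+1.
  by move=> E; rewrite crossingsS jumpX addbA -E /jump addbA addbb.
have before m (m_lt : m < perimeter) :
    ((Ordinal m_lt, false) \in C) = (start \in C) (+) crossings X m.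
  elim: m m_lt => [|m IHm] m_lt.
    rewrite /crossings take0 /= addbF; congr (_ \in C); congr (_, _).
    exact: val_inj.
  pose p : half_edge r := Ordinal (ltnW m_lt).
  have -> : (Ordinal m_lt, false) = @vertex_arc B (p, true).
    rewrite /= /rotation_arc /=; congr (_, _).
    by apply: val_inj; rewrite /= modn_small.
  by rewrite arcE (after p) ?IHm.
have CP (x : corner B) : (x \in C) = (start \in C) (+) crossings X (x.1 + x.2).
  case: x => [[m m_lt] []] /=; rewrite ?addn1 ?addn0; last exact: before.
  by apply: after; exact: before.
exists (start \in C, X); last first.
  by apply/setP => x; rewrite [in RHS]inE; exact: CP.
rewrite inE /=; apply/andP; split.
  apply/subsetP => _ /imsetP[p jp ->]; apply: contraTT jp => /jumpA.
  by rewrite inE => ->.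
apply/forallP => p; apply/implyP => pA; have := acrossE (p, false).
rewrite /dual_across /= pA (CP (rotation_side _)) (CP (p, false)) /= addn0.
by move/addbI => E; apply/eqP/esym.
Qed.

(** Both sides count the boundary colourings of the subgraph with ribbon set
    [A]; the factor 2 is the colour at the origin of the tour. *)
Lemma card_bicoloured_edges A :
  2 ^ nb_vertices (partial_dual A) = 2 * #|bicoloured_edges A|.
Proof.
have stepsK : involutions (dual_steps A).
  exact: (conj (@dual_acrossK B A) (conj (@rotation_arcK r) I)).
have -> : nb_vertices (partial_dual A) = orbit_count (dual_steps A).
  by rewrite /nb_vertices /= eqn0Ngt perimeter_gt0.
rewrite -(card_colourings stepsK).
have -> : colourings (dual_steps A) =
    paint @: [set cX | cX.2 \in bicoloured_edges A].
  apply/setP => C; apply/idP/imsetP => [/paint_surj[cX cXP ->] | [cX]].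
    by exists cX => //; rewrite inE.
  by rewrite inE => cXP ->; apply: paint_colouring.
rewrite card_imset; last exact: paint_inj.
rewrite -[X in _ = X * _]card_bool -cardsT -cardsX.
by congr #|pred_of_set _|; apply/setP => -[c X]; rewrite in_setX !in_set.
Qed.

End NonEmpty.

End Tour.

Section Loop.

Variable r : signed_rotation.
Local Notation B := (bouquet_of_rotation r).

(** Between the two ends of a loop, the colour is changed by the loops of [X]
    met in between, and once more by the loop itself when it is twisted, since
    then the free side joins gaps with exactly one of its ends between them. *)
Lemma side_consistent_loop (X : {set edge B}) (p : half_edge r) s1 s2 s3 :
  tour r = s1 ++ label p :: s2 ++ label p :: s3 ->
  side_consistent X p =
  (odd (count (mem X) s2) == ~~ untwisted p && (label p \in X)).
Proof.
set e := label p => def_t.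
have lt1 : size s1 < size (val r).
  by rewrite -size_tour def_t size_cat /= addnS ltnS leq_addr.
have lt2 : size s1 + (size s2).+1 < size (val r).
  rewrite -size_tour def_t size_cat /= size_cat /= ltn_add2l ltnS addnS ltnS.
  exact: leq_addr.
pose p1 : half_edge r := Ordinal lt1; pose p2 : half_edge r := Ordinal lt2.
have lab q : label q = nth e (tour r) q.
  by rewrite /tour codomE (nth_map q) ?size_enum_ord ?nth_ord_enum.
have lab1 : label p1 = e by rewrite lab def_t /= nth_cat ltnn subnn.
have lab2 : label p2 = e.
  rewrite lab def_t /= nth_cat ltnNge leq_addr /= addKn /=.
  by rewrite nth_cat ltnn subnn.
have p21 : partner p1 = p2.
  apply/esym/eqP; rewrite -partnerE lab1 lab2 eqxx andbT -val_eqE /=.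
  by rewrite -[X in _ != X]addn0 eqn_add2l.
have c1 : crossings X (size s1) = odd (count (mem X) s1).
  by rewrite /crossings def_t take_size_cat.
have c2 : crossings X (size s1 + (size s2).+1) =
    odd (count (mem X) s1) (+) ((e \in X) (+) odd (count (mem X) s2)).
  rewrite /crossings def_t take_cat ltnNge leq_addr /= addKn /=.
  by rewrite take_size_cat // count_cat /= !oddD oddb.
have : (p == p1) || (p == p2).
  have [-> //|pp1] := eqVneq p p1.
  by rewrite -p21 -partnerE pp1 lab1 -/e eqxx.
rewrite /side_consistent; case/orP=> /eqP eq_p; rewrite [in LHS]eq_p.
  rewrite p21 /= c1; case up: (untwisted p1); rewrite ?addn1 ?addn0.
    rewrite -[(_ + _).+1]/(p2.+1) crossingsS /= c2 lab2 eq_p up.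
    by case: (e \in X); case: odd; case: odd.
  by rewrite c2 eq_p up /=; case: (e \in X); case: odd; case: odd.
rewrite -p21 partnerK untwisted_partner /= p21 /= c2.
rewrite eq_p -p21 untwisted_partner.
case up: (untwisted p1); rewrite ?addn1 ?addn0.
  rewrite -[(_).+1]/(p1.+1) crossingsS /= c1 lab1.
  by case: (e \in X); case: odd; case: odd.
by rewrite c1 /=; case: (e \in X); case: odd; case: odd.
Qed.

End Loop.

(** * The Euler genus of a partial dual of a bouquet *)

Lemma eq_orbit_count (T : finType) (fs gs : seq (T -> T)) :
  step fs =2 step gs -> orbit_count fs = orbit_count gs.
Proof. by move=> eq_fg; apply: eq_n_comp; apply: eq_connect. Qed.

(** Taking the complement of the ribbon set exchanges the vertex-discs and the
    boundary components of the partial dual. *)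
Lemma nb_boundaries_dual (G : ribbon_graph) (A : {set edge G}) :
  nb_boundaries (partial_dual A) = nb_vertices (partial_dual (~: A)).
Proof.
congr (_ + _); apply: eq_orbit_count => x y /=.
by rewrite /step /= /dual_side /dual_across in_setC; case: (_ \in A).
Qed.

Lemma nb_components_dual (G : ribbon_graph) (A : {set edge G}) :
  nb_components (partial_dual A) = nb_components G.
Proof.
congr (_ + _); apply: eq_orbit_count => x y /=.
by rewrite /step /= /dual_side /dual_across; case: (_ \in A); rewrite // orbCA.
Qed.

(** The two constant colourings are invariant under all three involutions, and
    already [across] and [vertex_arc] allow only two colourings, as their orbits
    are the vertices. *)
Lemma bouquet_connected (r : signed_rotation) :
  0 < size (val r) -> nb_components (bouquet_of_rotation r) = 1.
Proof.
move=> r_gt0; have := bouquet_one_vertex r.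
have iso0 : isolated (bouquet_of_rotation r) = 0 by rewrite /= eqn0Ngt r_gt0.
rewrite /nb_vertices /nb_components iso0 => v1.
have cK : involutions [:: @rotation_across r; @rotation_arc r].
  exact: (conj (@rotation_acrossK r) (conj (@rotation_arcK r) I)).
have sK :
    involutions [:: @rotation_side r; @rotation_across r; @rotation_arc r].
  exact: (conj (@rotation_sideK r) cK).
have := card_colourings sK; have := card_colourings cK.
rewrite [orbit_count _]v1.
set col2 := colourings _; set col3 := colourings _ => card2 card3.
have sub32 : col3 \subset col2.
  by apply/subsetP => C; rewrite !inE /= => /andP[].
have sub13 : [set set0; setT] \subset col3.
  apply/subsetP => C; rewrite !inE /=.
  by case/orP=> /eqP->; rewrite ?preimset0 ?preimsetT !eqxx.
have x0 : half_edge_corner r := (Ordinal r_gt0, false).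
have card1 : #|[set set0; [set: half_edge_corner r]]| = 2.
  rewrite cards2; by case: eqP => // /setP/(_ x0); rewrite !inE.
have := subset_leq_card sub32; have := subset_leq_card sub13.
rewrite card1 {}card2 {}card3 add0n; move: (orbit_count _) => [|[|k]] //.
by rewrite leq_exp2l.
Qed.

Lemma euler_genus_dual (r : signed_rotation)
    (A : {set edge (bouquet_of_rotation r)}) : 0 < size (val r) ->
  euler_genus (partial_dual A) =
  2 + #|edge (bouquet_of_rotation r)|
  - (nb_vertices (partial_dual A) + nb_vertices (partial_dual (~: A))).
Proof.
move=> r_gt0.
by rewrite /euler_genus nb_components_dual nb_boundaries_dual bouquet_connected.
Qed.

(** The predecessor makes the formula right for empty [S] too, where it gives
    the single subset [set0].  When [S] contains [a], exactly one of [Y] and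
    [a |: Y] is even, for each subset [Y] of [S :\ a]. *)
Lemma card_even_subsets (T : finType) (S : {set T}) :
  #|[set X : {set T} | (X \subset S) && ~~ odd #|X|]| = 2 ^ #|S|.-1.
Proof.
have [-> | [a aS]] := set_0Vmem S.
  rewrite cards0 /= expn0 -(cards1 (set0 : {set T})); apply: eq_card => X.
  by rewrite !inE subset0; case: eqP => // ->; rewrite cards0.
rewrite (cardsD1 a) aS add1n /= -card_powerset.
pose fix_parity (Y : {set T}) := if odd #|Y| then a |: Y else Y.
have aY Y : Y \in powerset (S :\ a) -> a \notin Y.
  by rewrite powersetE => /subsetP YS; apply/negP => /YS; rewrite !inE eqxx.
rewrite -(@card_in_imset _ _ fix_parity); last first.
  move=> Y Z /aY aNY /aY aNZ eqYZ.
  suff K (Y0 : {set T}) : a \notin Y0 -> fix_parity Y0 :\ a = Y0.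
    by rewrite -(K Y) // eqYZ K.
  rewrite /fix_parity => aY0; case: ifP => _; first by rewrite setU1K.
  by apply/setP => x; rewrite !inE; case: eqP => // ->; rewrite (negPf aY0).
apply: eq_card => X; rewrite inE; apply/andP/imsetP => [[XS evX] | [Y YS ->]].
  exists (X :\ a); first by rewrite powersetE setSD.
  rewrite /fix_parity; case aX: (a \in X).
    by move: evX; rewrite (cardsD1 a) aX oddD /= negbK => ->; rewrite setD1K.
  have -> : X :\ a = X by apply/setP => x; rewrite !inE; case: eqP => // ->.
  by rewrite (negPf evX).
have aY0 := aY _ YS; move: YS; rewrite powersetE subsetD1 => /andP[YS _].
rewrite /fix_parity; case: ifP => oY; last by rewrite YS oY.
by rewrite subUset sub1set aS YS cardsU1 aY0 oddD oY.
Qed.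

(** * Boundary colourings for B_{2n+1} *)

Section BouquetB.

Variable n : nat.

Local Notation B := (bouquet_B n).
Local Notation loop := (option ('I_n * bool)).
Local Notation twisted := (None : loop).
Local Notation r :=
  (exist _ (rotation_B n) (rotation_B_signed n) : signed_rotation).

(** The index [None] stands for the loop 1, and [Some (i, c)] for the loop
    2(i + 1) + c, as [i] starts from 0. *)
Definition edge_number (x : loop) : nat :=
  if x is Some (i, c) then 2 * i.+1 + c else 1.

Definition loop_pairs (s : seq 'I_n) : seq loop :=
  flatten [seq [:: Some (i, false); Some (i, true)] | i <- s].

Definition half_tour : seq loop := twisted :: loop_pairs (enum 'I_n).

Definition loop_tour : seq loop :=
  half_tour ++ twisted :: loop_pairs (rev (enum 'I_n)).

Lemma edge_number_loop_pairs s :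
  map edge_number (loop_pairs s) =
  flatten [seq [:: 2 * j; 2 * j + 1] | j <- [seq (val i).+1 | i <- s]].
Proof.
rewrite map_flatten -!map_comp; congr flatten.
by apply: eq_map => i /=; rewrite addn0.
Qed.

Lemma iota_pairs m k :
  iota (2 * m) (2 * k) = flatten [seq [:: 2 * j; 2 * j + 1] | j <- iota m k].
Proof.
elim: k m => // k IHk m.
by rewrite [2 * k.+1]mulnS /= -IHk addn1 [2 * m.+1]mulnS.
Qed.

Lemma succ_enum_ord : [seq (val i).+1 | i <- enum 'I_n] = iota 1 n.
Proof. by rewrite (@map_comp _ _ _ S val) val_enum_ord -(iotaDl 1 0). Qed.

Lemma edge_number_half_tour : map edge_number half_tour = iota 1 (2 * n + 1).
Proof.
by rewrite /= edge_number_loop_pairs succ_enum_ord -iota_pairs addn1.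
Qed.

Lemma half_tour_perm : perm_eq half_tour (enum {: loop}).
Proof.
apply: uniq_perm; rewrite ?enum_uniq //.
  apply: (@map_uniq _ _ edge_number).
  by rewrite edge_number_half_tour iota_uniq.
move=> x; rewrite mem_enum inE; case: x => [[i b]|] //=; apply/flatten_mapP.
by exists i; rewrite ?mem_enum //; case: b; rewrite !inE eqxx ?orbT.
Qed.

Lemma card_loop_set (X : {set loop}) : #|X| = count (mem X) half_tour.
Proof. by rewrite (permP half_tour_perm) cardE -size_filter enumT. Qed.

Lemma edge_number_tour : map edge_number loop_tour = labels r.
Proof.
rewrite /loop_tour map_cat edge_number_half_tour /= edge_number_loop_pairs.
rewrite map_rev succ_enum_ord /labels /= /rotation_B map_cat /=.
congr (_ ++ _ :: _); first by rewrite -map_comp map_id_in.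
by rewrite map_flatten; congr flatten; rewrite -map_comp.
Qed.

Lemma edge_number_in (x : loop) : edge_number x \in labels r.
Proof.
rewrite (perm_mem (rotation_B_labels n)) mem_cat orbb mem_iota /edge_number.
by case: x => [[[i i_lt] []]|] /=; lia.
Qed.

Definition edge_of (x : loop) : edge B := SeqSub (edge_number_in x).

Lemma edge_of_inj : injective edge_of.
Proof.
move=> [[i b]|] [[j c]|] /(congr1 val) //= E; try lia.
have bc : b = c by case: b c E => [] [] /=; lia.
congr (Some (_, _)) => //; apply: val_inj; move: E; rewrite bc /=; lia.
Qed.

Lemma edge_of_onto e : exists x, edge_of x = e.
Proof.
case: e => k k_in; have := k_in.
rewrite (perm_mem (rotation_B_labels n)) mem_cat orbb mem_iota => k_bd.
have [k1 | k_neq1] := eqVneq k 1; first by exists twisted; apply: val_inj.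
have i_lt : k./2.-1 < n by lia.
exists (Some (Ordinal i_lt, odd k)); apply: val_inj => /=; lia.
Qed.

Lemma tour_B : tour r = map edge_of loop_tour.
Proof.
apply: (inj_map val_inj); rewrite -[RHS]map_comp; apply/esym.
apply: (etrans edge_number_tour); rewrite /tour codomE -map_comp.
rewrite /labels /= -{1}[rotation_B n](map_tnth_enum (in_tuple (rotation_B n))).
by rewrite -map_comp.
Qed.

Lemma perimeter_B : 0 < size (rotation_B n).
Proof. by rewrite size_cat addnS. Qed.

Lemma card_edge_B : #|edge B| = 2 * n + 1.
Proof.
have E : edge_of @: setT = setT.
  apply/setP => e; rewrite inE.
  by have [x <-] := edge_of_onto e; rewrite imset_f.
rewrite -cardsT -E card_imset; last exact: edge_of_inj.
by rewrite cardsT card_option card_prod card_ord card_bool; lia.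
Qed.

(** The only negative entry is -1, so both ends of any loop but 1 are positive,
    and the ends of the loop 1 are the entries 1 and -1. *)
Lemma untwisted_B (p : half_edge r) x :
  label p = edge_of x -> untwisted p = (x != twisted).
Proof.
have labE (q : half_edge r) y :
    label q = edge_of y -> `|entry q|%N = edge_number y.
  by move/(congr1 val).
case: x => [[i b]|] lab_p /=.
  have pos (q : half_edge r) :
      label q = edge_of (Some (i, b)) -> (entry q < 0)%R = false.
    move/labE; have := mem_tnth q (in_tuple (rotation_B n)).
    rewrite -/(entry q) mem_cat inE.
    case/or3P=> [/mapP[k _ ->] | /eqP-> /= | /flattenP[_ /mapP[k _ ->]]] //.
      by lia.
    by rewrite !inE => /orP[]/eqP->.
  by rewrite /untwisted !pos // label_partner.
have [a ea] : exists a : half_edge r, entry a = 1%R.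
  have /(tnthP (in_tuple (rotation_B n)))[a ->] : 1%R \in rotation_B n.
    by rewrite /rotation_B addn1.
  by exists a.
have [b eb] : exists b : half_edge r, entry b = (-1)%R.
  have /(tnthP (in_tuple (rotation_B n)))[b ->] : (-1)%R \in rotation_B n.
    by rewrite /rotation_B mem_cat inE eqxx orbT.
  by exists b.
have lab_a : label a = edge_of twisted by apply: val_inj; rewrite /= ea.
have lab_b : label b = edge_of twisted by apply: val_inj; rewrite /= eb.
have ab : b = partner a.
  apply/eqP; rewrite -partnerE lab_a lab_b eqxx andbT.
  by apply: contra_eq_neq eb => ->; rewrite ea.
have a_tw : untwisted a = false by rewrite /untwisted -ab ea eb.
(* [a] and [b] are the two ends of the loop 1, so [p] is one of them *)
have [-> // | pa] := eqVneq p a.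
have := partnerE a p; rewrite pa lab_a lab_p eqxx => /esym/eqP->.
by rewrite untwisted_partner.
Qed.

Lemma odd_count_pairs (X : {set loop}) s :
  (forall i, (Some (i, false) \in X) = (Some (i, true) \in X)) ->
  odd (count (mem X) (loop_pairs s)) = false.
Proof.
move=> XP; elim: s => //= i s IHs.
by rewrite XP !oddD IHs addbF addbb.
Qed.

Lemma odd_count_rev_pairs (X : {set loop}) s :
  odd (count (mem X) (loop_pairs (rev s))) = odd (count (mem X) (loop_pairs s)).
Proof.
congr odd; apply/permP: (mem X); apply: perm_flatten; apply: perm_map.
by rewrite perm_rev.
Qed.

Definition mate (x : 'I_n * bool) : loop := Some (x.1, ~~ x.2).

(** Between the two ends of the loop 2i or 2i+1 lie the loop 1 once, its mate
    once, and all the loops of higher pairs twice.  Between the two ends of the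
    loop 1 lie all the other loops once, and the twist adds the loop 1. *)
Lemma side_consistent_B (X : {set loop}) (p : half_edge r) x :
  label p = edge_of x ->
  side_consistent (edge_of @: X) p =
  if x is Some y then (mate y \in X) == (twisted \in X) else ~~ odd #|X|.
Proof.
move=> lab_p.
have XE y : (edge_of y \in edge_of @: X) = (y \in X).
  by rewrite mem_imset //; exact: edge_of_inj.
have countE s :
    count (mem (edge_of @: X)) (map edge_of s) = count (mem X) s.
  by rewrite count_map; apply: eq_count => y /=; exact: XE.
have tourE s1 s2 s3 : loop_tour = s1 ++ x :: s2 ++ x :: s3 ->
    side_consistent (edge_of @: X) p =
    (odd (count (mem X) s2) == (x == twisted) && (x \in X)).
  move=> def_t; have := tour_B.
  rewrite def_t map_cat /= map_cat /= -lab_p => /side_consistent_loop->.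
  by rewrite countE lab_p XE (untwisted_B lab_p) negbK.
case: x lab_p tourE => [[i b]|] lab_p tourE.
  have [s1 [s2 def_enum]] : exists s1 s2, enum 'I_n = s1 ++ i :: s2.
    by have := mem_enum 'I_n i; case/splitPr => s1 s2; exists s1, s2.
  have pairs_cat s t : loop_pairs (s ++ t) = loop_pairs s ++ loop_pairs t.
    by rewrite /loop_pairs map_cat flatten_cat.
  have def_t : loop_tour = twisted :: loop_pairs s1
      ++ [:: Some (i, false), Some (i, true) & loop_pairs s2
      ++ twisted :: loop_pairs (rev s2)
      ++ [:: Some (i, false), Some (i, true) & loop_pairs (rev s1)]].
    rewrite /loop_tour /half_tour def_enum rev_cat rev_cons -cats1 !pairs_cat.
    by rewrite /= -?catA /= -?catA.
  case: b lab_p tourE => lab_p.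
    move/(_ (twisted :: loop_pairs s1 ++ [:: Some (i, false)])
      (loop_pairs s2 ++ twisted :: loop_pairs (rev s2) ++ [:: Some (i, false)])
      (loop_pairs (rev s1))) => -> /=.
      rewrite count_cat /= count_cat /= addn0 !oddD odd_count_rev_pairs !oddb.
      by rewrite /mate /=; case: odd; do 2!case: (_ \in X).
    by rewrite def_t /= -?catA /= -?catA.
  move/(_ (twisted :: loop_pairs s1)
      (Some (i, true) :: loop_pairs s2 ++ twisted :: loop_pairs (rev s2))
      (Some (i, true) :: loop_pairs (rev s1))) => -> /=.
    rewrite count_cat /= !oddD odd_count_rev_pairs !oddb /mate /=.
    by case: odd; do 2!case: (_ \in X).
  by rewrite def_t /= -?catA /= -?catA.
rewrite (tourE [::] (loop_pairs (enum 'I_n))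
  (loop_pairs (rev (enum 'I_n)))) //=.
by rewrite card_loop_set /= oddD oddb; case: odd; case: (_ \in X).
Qed.

(** The only loops of [A] whose two sides can have different colours. *)
Definition unmated (A : {set loop}) : {set loop} :=
  [set x in A | if x is Some y then mate y \notin A else false].

(** If the loop 1 were in [X], each loop 2i or 2i+1 of [X] would have its mate
    in [X], and the condition at the loop 1 would fail by parity.  Without the
    loop 1 in [X], a loop of [A] forces its mate out of [X]. *)
Lemma bicoloured_B (X A : {set loop}) :
  (edge_of @: X \in bicoloured_edges (edge_of @: A)) =
  (X \subset unmated A) && ((twisted \in A) ==> ~~ odd #|X|).
Proof.
have mem_edge (Y : {set loop}) y : (edge_of y \in edge_of @: Y) = (y \in Y).
  by rewrite mem_imset //; exact: edge_of_inj.
rewrite inE; apply/andP/andP => [[/subsetP XA /forallP ret]|[/subsetP XS evX]].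
  have {}XA x : x \in X -> x \in A by have := XA (edge_of x); rewrite !mem_edge.
  have {}ret x : x \in A ->
      if x is Some y then (mate y \in X) == (twisted \in X) else ~~ odd #|X|.
    move=> xA; have [[p b] /= lab_p] := rotation_ribbon_onto (edge_of x).
    by have := ret p; rewrite (side_consistent_B _ lab_p) lab_p mem_edge xA.
  have twX : twisted \in X = false.
    apply/negP => twX; have := ret _ (XA _ twX).
    rewrite (card_loop_set X) /= twX oddD /=.
    rewrite odd_count_pairs // => i; apply/idP/idP => iX.
      by have := ret _ (XA _ iX); rewrite twX => /eqP.
    by have := ret _ (XA _ iX); rewrite twX => /eqP.
  split; last by apply/implyP => /ret.
  apply/subsetP => x xX; rewrite inE XA //=.
  case: x xX => [[i b]|] xX; last by rewrite twX in xX.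
  apply/negP => /ret.
  by rewrite /mate /= negbK xX twX.
have XA : X \subset A by apply/subsetP => x /XS; rewrite inE => /andP[].
have twX : twisted \in X = false by apply/negP => /XS; rewrite inE andbF.
split; first exact: imsetS.
apply/forallP => p; apply/implyP; have [x lab_p] := edge_of_onto (label p).
rewrite -lab_p mem_edge => xA; rewrite (side_consistent_B _ (esym lab_p)) twX.
case: x xA {lab_p} => [[i b]|] xA; last exact: implyP evX xA.
apply/eqP/negP => /XS; rewrite inE => /andP[_].
by rewrite /mate /= negbK xA.
Qed.

Definition split_pairs (A : {set loop}) : {set 'I_n} :=
  [set i | (Some (i, false) \in A) != (Some (i, true) \in A)].

Lemma card_unmated A : #|unmated A| = #|split_pairs A|.
Proof.
(* the member in [A] of the split pair [i] *)
pose member i : loop := Some (i, Some (i, true) \in A).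
rewrite -(@card_imset _ _ member) => [|i j []//].
apply: eq_card => x; rewrite inE; apply/andP/imsetP => [[]|[i]].
  case: x => [[i b]|] // xA mA; exists i; last congr (Some (_, _)).
    by rewrite inE; case: b xA mA; rewrite /mate /= => -> /negPf->.
  by case: b xA mA; rewrite /mate /=; [move=> -> | move=> _ /negPf->].
rewrite inE /member => iA ->; move: iA; case iA: (Some (i, true) \in A);
  rewrite /mate /=.
  by rewrite iA; case: (_ \in A).
by rewrite iA; case: (_ \in A).
Qed.

Lemma split_pairsC A : split_pairs (~: A) = split_pairs A.
Proof. by apply/setP => i; rewrite !inE; do 2!case: (_ \in A). Qed.

(** The predecessor is truncated at 0: with the twisted loop in [A] and no split
    pair there is one boundary component, as there is with one split pair. *)
Lemma nb_vertices_B (A : {set loop}) :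
  nb_vertices (partial_dual (edge_of @: A)) =
  (if twisted \in A then #|split_pairs A|.-1 else #|split_pairs A|).+1.
Proof.
apply: (@expnI 2) => //; rewrite card_bicoloured_edges ?perimeter_B // expnS.
congr (2 * _).
pose S := [set X : {set loop} |
  (X \subset unmated A) && ((twisted \in A) ==> ~~ odd #|X|)].
transitivity #|S|.
  rewrite -(card_imset (mem S) (imset_inj edge_of_inj)).
  apply: eq_card => Y; apply/idP/imsetP => [YB | [X XS ->]]; last first.
    by rewrite bicoloured_B; move: XS; rewrite inE.
  have defY : Y = edge_of @: (edge_of @^-1: Y).
    apply/setP => e; have [x <-] := edge_of_onto e.
    by rewrite mem_imset ?inE //; exact: edge_of_inj.
  exists (edge_of @^-1: Y) => //.
  by rewrite inE -bicoloured_B -defY.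
rewrite -card_unmated /S; case: (twisted \in A) => /=.
  exact: card_even_subsets.
by rewrite -card_powerset; apply: eq_card => X; rewrite !inE andbT.
Qed.

Lemma euler_genus_B (A : {set loop}) (d := #|split_pairs A|) :
  euler_genus (partial_dual (edge_of @: A)) =
  if d == 0 then 2 * n + 1 else 2 * n - 2 * d + 2.
Proof.
have d_le : d <= n by rewrite -[X in _ <= X]card_ord max_card.
have -> : euler_genus (partial_dual (edge_of @: A)) =
    2 + #|edge B| - (d.+1 + d.-1.+1).
  rewrite euler_genus_dual ?perimeter_B //; congr (_ - _).
  have -> : ~: (edge_of @: A) = edge_of @: (~: A).
    apply/setP => e; have [x <-] := edge_of_onto e.
    by rewrite inE !mem_imset ?inE //; exact: edge_of_inj.
  rewrite !nb_vertices_B split_pairsC inE -/d.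
  by case: (twisted \in A) => //=; rewrite addnC.
by rewrite card_edge_B; clearbody d; case: eqP => d0; lia.
Qed.

End BouquetB.

(** * Counting the sets of loops by their split pairs *)

Section Count.

Variables (n : nat) (V : nmodType).
Local Notation loop := (option ('I_n * bool)).

(** A set of loops amounts to its split pairs, the presence of the loop 1, and
    the presence of the even member of each pair: the last two data are free and
    give the factor. *)
Lemma sum_split_pairs (F : {set 'I_n} -> V) :
  (\sum_(A : {set loop}) F (split_pairs A) =
   (\sum_(D : {set 'I_n}) F D) *+ 2 ^ (n + 1))%R.
Proof.
pose build (t : (bool * {set 'I_n}) * {set 'I_n}) : {set loop} :=
  [set x : loop | if x is Some (i, b) then (i \in t.1.2) (+) (b && (i \in t.2))
                  else t.1.1].
pose unbuild (A : {set loop}) :=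
  ((None \in A, [set i | Some (i, false) \in A]), split_pairs A).
have buildK : cancel build unbuild.
  move=> [[c S] D]; rewrite /unbuild /build; congr (_, _, _).
  - by rewrite inE.
  - by apply/setP => i; rewrite !inE addbF.
  - by apply/setP => i; rewrite !inE /=; do 2!case: (i \in _).
have unbuildK : cancel unbuild build.
  move=> A; apply/setP => -[[i b]|]; rewrite !inE //=.
  by case: b; do 2!case: (_ \in A).
rewrite (reindex build) /=; last first.
  by exists unbuild => ? _; [exact: buildK | exact: unbuildK].
transitivity (\sum_(t : (bool * {set 'I_n}) * {set 'I_n}) F t.2)%R.
  by apply: eq_bigr => t _; congr F; rewrite -[in RHS](buildK t).
rewrite -(pair_bigA _ (fun _ D => F D)) /= sumr_const card_prod card_bool.
by rewrite -cardsT -powersetT card_powerset cardsT card_ord addn1 expnS.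
Qed.

Lemma sum_subsets_card (G : nat -> V) :
  (\sum_(D : {set 'I_n}) G #|D| = \sum_(s < n.+1) G s *+ 'C(n, s))%R.
Proof.
have card_le (D : {set 'I_n}) : #|D| < n.+1.
  by rewrite ltnS -[X in _ <= X]card_ord max_card.
rewrite (partition_big (fun D : {set 'I_n} => Ordinal (card_le D)) predT) //=.
apply: eq_bigr => s _; rewrite (eq_bigr (fun=> G s)) => [|D /eqP<- //].
rewrite sumr_const -[X in 'C(X, _)]card_ord -card_draws; congr (_ *+ _)%R.
by apply: eq_card => D; rewrite !inE.
Qed.

End Count.

Local Open Scope ring_scope.

Theorem theorem6 (n : nat) (hn : (1 <= n)%N) :
  partial_dual_genus_poly (bouquet_B n) =
    (2 ^ (n + 1))%N%:R *: 'X^(2 * n + 1)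
    + \sum_(1 <= s < n.+1)
        (2 ^ (n + 1) * 'C(n, s))%N%:R *: 'X^(2 * n - 2 * s + 2).
Proof.
pose G d : {poly int} := 'X^(if d == 0 then 2 * n + 1 else 2 * n - 2 * d + 2)%N.
have -> : partial_dual_genus_poly (bouquet_B n) =
    \sum_(A : {set option ('I_n * bool)}) G #|split_pairs A|.
  pose edges (A : {set option ('I_n * bool)}) := @edge_of n @: A.
  rewrite /partial_dual_genus_poly (reindex edges) /=.
    by apply: eq_bigr => A _; rewrite euler_genus_B.
  exists (fun A : {set edge (bouquet_B n)} => @edge_of n @^-1: A) => A _;
    apply/setP => x.
    by rewrite inE mem_imset //; exact: edge_of_inj.
  have [y <-] := edge_of_onto x.
  by rewrite mem_imset ?inE //; exact: edge_of_inj.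
rewrite (sum_split_pairs (fun D => G #|D|)) sum_subsets_card big_ord_recl bin0.
rewrite mulrnDl scaler_nat big_add1 big_mkord; congr (_ + _).
rewrite -sumrMnl; apply: eq_bigr => s _.
by rewrite scaler_nat [(2 ^ _ * _)%N]mulnC mulrnA.
Qed.
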